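(* Suppose a strongly regular graph $\Delta$ with parameters $(640,243,66,108)$ exists, and let $x\in\operatorname{Aut}(\Delta)$ have order $5$ with $\operatorname{Fix}(x)=\varnothing$. Then $a_1(x)=240$.
   Context: A strongly regular graph with parameters $(v,k,\lambda,\mu)$ is a finite simple $k$-regular graph on $v$ vertices in which any two adjacent vertices have exactly $\lambda$ common neighbours and any two distinct non-adjacent vertices have exactly $\mu$ common neighbours. For an automorphism $x$ of $\Delta$, $\operatorname{Fix}(x)$ is the subgraph induced on the vertices fixed by $x$ (so $\operatorname{Fix}(x)=\varnothing$ means that $x$ fixes no vertex), and $a_1(x)=|\{u\in V(\Delta):u\sim x(u)\}|$ is the number of vertices adjacent to their image under $x$. *)

(* Defs.v *)
From mathcomp Require Import all_boot all_fingroup.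

Set Implicit Arguments.
Unset Strict Implicit.
Unset Printing Implicit Defensive.

(* A finite simple graph with vertex type V is given by its adjacency relation. *)
Definition simple_graph (V : finType) (adj : rel V) : Prop :=
  symmetric adj /\ irreflexive adj.

Definition neighbours (V : finType) (adj : rel V) (u : V) : {set V} :=
  [set w | adj u w].

Record strongly_regular (V : finType) (adj : rel V) (v k lambda mu : nat) :
    Prop := StronglyRegular {
  srg_simple : simple_graph adj;
  srg_order : #|V| = v;
  srg_regular : forall u : V, #|neighbours adj u| = k;
  srg_adjacent : forall u w : V, adj u w ->
    #|neighbours adj u :&: neighbours adj w| = lambda;
  srg_nonadjacent : forall u w : V, u != w -> ~~ adj u w ->
    #|neighbours adj u :&: neighbours adj w| = mu
}.

Definition graph_Aut (V : finType) (adj : rel V) : {set {perm V}} :=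
  [set x : {perm V} | [forall u, forall w, adj (x u) (x w) == adj u w]].

(* The vertex set of the induced subgraph Fix(x). *)
Definition fixed_vertices (V : finType) (x : {perm V}) : {set V} :=
  [set u | x u == u].

Definition a1 (V : finType) (adj : rel V) (x : {perm V}) : nat :=
  #|[set u | adj u (x u)]|.

(* Main.v *)
Require Import Defs.
From mathcomp Require Import all_boot all_fingroup.
From mathcomp Require Import all_algebra.
From mathcomp Require Import ring.

(** The adjacency matrix A has eigenvalues k = 243 (on the constants), r = 3
    and s = -45; J is the all-ones matrix. Let x be a fixed-point-free
    automorphism of prime order p. The proof computes tr (A^n x), the number
    of walks of length n from some vertex u to x u, in two ways when n = p^m.

    Combinatorially, such a walk (u_0, ..., u_(n-1), x u_0) extends to a
    bi-infinite walk with u_(i+n) = x u_i, and shifting the index by one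
    permutes these walks, as x preserves adjacency. The n-th power of the
    shift is x itself, applied to every vertex, so it moves every walk, while
    the (p n)-th power is the identity. All orbits of the shift therefore have
    exactly p^(m+1) elements, and p^(m+1) divides tr (A^n x)
    ([dvdn_sum_walks]).

    Algebraically, the spectral decomposition writes A^n as a combination of
    A, I and J; since x fixes no vertex this gives ([srg_sum_walks])
      (r - s) tr (A^n x) = (r^n - s^n) (a1(x) - (k - r)) + (r - s) (k^n - r^n).

    If p divides k - r, then k^n = r^n modulo p^(m+1); if p does not divide
    r - s, then r^n - s^n is prime to p. Hence a1(x) = k - r modulo p^(m+1)
    for every m, that is, a1(x) = k - r ([srg_a1_fixed_point_free]). Here
    p = 5 divides 243 - 3 = 240 and does not divide 3 + 45 = 48.

    Behind this lies the fact that the projection onto the s-eigenspace is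
    p-integral, so that its image is a projective, hence free, module over the
    p-adic group ring of <x>, and x has trace 0 on it. *)

Set Implicit Arguments.
Unset Strict Implicit.
Unset Printing Implicit Defensive.

Import GRing.Theory.

(** * Counting the orbits of a map of prime power order *)

Section FreeAction.

Variables (T : finType) (f : T -> T).

Lemma order_dvdn_iter (t : T) (n : nat) :
  injective f -> iter n f t = t -> fingraph.order f t %| n.
Proof.
move=> f_inj fnt; set d := fingraph.order f t.
have d_gt0 : 0 < d by exact: fingraph.order_gt0.
have fd k : iter (k * d) f t = t.
  by elim: k => // k IHk; rewrite mulSn iterD IHk iter_order.
have frem : iter (n %% d) f t = t.
  by move: fnt; rewrite {1}(divn_eq n d) addnC iterD fd.
by rewrite /dvdn -(findex_iter (ltn_pmod n d_gt0)) frem findex0.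
Qed.

(** The length of an orbit divides p^(m+1); a shorter orbit would have length
    dividing p^m, and f^(p^m) would fix its points. *)
Lemma card_fclosed_prime_power (p m : nat) (A : {pred T}) :
  prime p -> injective f -> fclosed f A ->
  (forall t, iter (p ^ m.+1) f t = t) ->
  (forall t, iter (p ^ m) f t != t) ->
  p ^ m.+1 %| #|A|.
Proof.
move=> p_pr f_inj clA f_per f_free.
suff ord t : fingraph.order f t = p ^ m.+1.
  rewrite -(@fcard_order_set _ f f_inj (p ^ m.+1) A _ clA) ?dvdn_mull //.
  by apply/subsetP=> t _; rewrite inE ord.
have /(dvdn_pfactor _ _ p_pr)[e] := order_dvdn_iter f_inj (f_per t).
rewrite leq_eqVlt => /orP[/eqP-> // | lt_em] ordE.
case/negP: (f_free t); apply/eqP; rewrite -(subnK (lt_em : e <= m)) expnD -ordE.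
elim: (p ^ _) => // k IHk.
by rewrite mulSn iterD IHk iter_order.
Qed.

End FreeAction.

(** * Walks closed up by an automorphism *)

Section TwistedWalks.

Variables (V : finType) (adj : rel V).

(** The entry (u, w) of the n-th power of the adjacency matrix. *)
Fixpoint walks (n : nat) (u w : V) : nat :=
  if n is n'.+1 then \sum_(v | adj u v) walks n' v w else u == w.

Lemma sum_tuple_cons (n : nat) (F : seq V -> nat) :
  \sum_(s : n.+1.-tuple V) F s
    = \sum_(v : V) \sum_(s : n.-tuple V) F (v :: s).
Proof.
rewrite pair_big /=.
rewrite (reindex (fun q : V * n.-tuple V => cons_tuple q.1 q.2)) //=.
exists (fun s : n.+1.-tuple V => (thead s, behead_tuple s)) => [[v s]|s] _ /=.
  by congr pair; apply: val_inj.
by apply: val_inj; case/tupleP: s.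
Qed.

Lemma sum_walk_tuples (n : nat) (u w : V) :
  \sum_(s : n.-tuple V) path adj u (rcons s w) = walks n.+1 u w.
Proof.
elim: n u => [|n IHn] u.
  rewrite (big_pred1 [tuple]) => [|s]; last by apply/esym/eqP; exact: tuple0.
  rewrite /= andbT big_mkcond /= (bigD1 w) //= eqxx big1 => [|v /negPf->].
    by rewrite addn0; case: (adj u w).
  by case: ifP.
rewrite (sum_tuple_cons _ (fun s => path adj u (rcons s w) : nat)).
rewrite [RHS]big_mkcond.
apply: eq_bigr => v _ /=.
by case: (adj u v) => /=; [exact: IHn | rewrite big1].
Qed.

Variable x : {perm V}.

(** The list [:: u_0; ...; u_(n-1)] stands for the bi-infinite sequence with
    u_(i+n) = x u_i, and [twist] shifts that sequence by one place. *)
Definition twist (s : seq V) : seq V :=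
  if s is u :: s' then rcons s' (x u) else [::].

Definition twisted_closed (s : seq V) : bool :=
  if s is u :: s' then path adj u (rcons s' (x u)) else true.

Lemma card_twisted_closed (n : nat) :
  #|[pred s : n.+1.-tuple V | twisted_closed s]|
    = \sum_u walks n.+1 u (x u).
Proof.
rewrite -sum1_card big_mkcond /=.
rewrite (eq_bigr (fun s : n.+1.-tuple V => (twisted_closed s : nat))); last first.
  by move=> s _; rewrite inE; case: twisted_closed.
rewrite (sum_tuple_cons _ (fun s => twisted_closed s : nat)).
by apply: eq_bigr => u _; exact: sum_walk_tuples.
Qed.

Lemma twisted_closed_twist (s : seq V) :
  x \in graph_Aut adj -> twisted_closed (twist s) = twisted_closed s.
Proof.
rewrite inE => /forallP x_aut.
have xE u w : adj (x u) (x w) = adj u w by apply/eqP/(forallP (x_aut u)).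
case: s => [|u [|v s]] //=; first by rewrite xE.
by rewrite rcons_path last_rcons xE andbC.
Qed.

Lemma size_twist (s : seq V) : size (twist s) = size s.
Proof. by case: s => //= u s; rewrite size_rcons. Qed.

Lemma twist_inj : injective twist.
Proof.
move=> [|u s] [|v t] //=.
- by move/(congr1 size); rewrite size_rcons.
- by move/(congr1 size); rewrite size_rcons.
- by case/rcons_inj=> -> /perm_inj ->.
Qed.

(** Shifting by a whole period applies x to every vertex; the suffix t makes
    the statement inductive. *)
Lemma iter_twist_cat (s t : seq V) :
  iter (size s) twist (s ++ t) = t ++ map x s.
Proof.
elim: s t => [|u s IHs] t; first by rewrite cats0.
by rewrite [size _]/= iterSr /= rcons_cat IHs cat_rcons.
Qed.

Lemma iter_twist_size (s : seq V) : iter (size s) twist s = map x s.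
Proof. by rewrite -{2}(cats0 s) iter_twist_cat. Qed.

Lemma iter_twist_mul_size (k : nat) (s : seq V) :
  iter (k * size s) twist s = map (x ^+ k)%g s.
Proof.
elim: k => [|k IHk].
  by rewrite expg0 -[LHS]map_id; apply: eq_map => u; rewrite perm1.
rewrite mulSn iterD IHk -[size s](size_map (x ^+ k)%g) iter_twist_size.
rewrite -map_comp.
by apply: eq_map => u /=; rewrite expgSr permM.
Qed.

Lemma twist_tupleP (n : nat) (s : n.-tuple V) : size (twist s) == n.
Proof. by rewrite size_twist size_tuple. Qed.

Canonical twist_tuple (n : nat) (s : n.-tuple V) := Tuple (twist_tupleP s).

(** The shift has order p^(m+1) on closed walks of period p^m, and its p^m-th
    power is free because x is. *)
Lemma dvdn_sum_walks (p m : nat) :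
  prime p -> x \in graph_Aut adj -> #[x]%g = p -> fixed_vertices x = set0 ->
  p ^ m.+1 %| \sum_u walks (p ^ m) u (x u).
Proof.
move=> p_pr x_aut x_ord x_fix.
have [n pmE] : exists n, p ^ m = n.+1.
  by exists (p ^ m).-1; rewrite prednK // expn_gt0 prime_gt0.
rewrite pmE -card_twisted_closed.
pose f (s : n.+1.-tuple V) := twist_tuple s.
have val_f k s : val (iter k f s) = iter k twist s by elim: k => //= k ->.
apply: (@card_fclosed_prime_power _ f) => //.
- by move=> s t /(congr1 val)/twist_inj/val_inj.
- by move=> s _ /eqP <-; rewrite !inE twisted_closed_twist.
- move=> s; apply: val_inj; rewrite val_f expnS pmE -{1}(size_tuple s).
  rewrite iter_twist_mul_size -x_ord expg_order -[RHS]map_id.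
  by apply: eq_map => u; rewrite perm1.
- move=> s; apply/eqP => /(congr1 val); rewrite val_f pmE -{1}(size_tuple s).
  rewrite iter_twist_size; case/tupleP: s => u s /= [xu _].
  by have := in_set0 u; rewrite -x_fix inE xu eqxx.
Qed.

End TwistedWalks.

(** * Powers of the adjacency matrix of a strongly regular graph *)

Section Spectral.

Local Open Scope ring_scope.

Variables (V : finType) (adj : rel V) (v k lambda mu : nat).
Hypothesis srg : strongly_regular adj v k lambda mu.
(* r and s are the eigenvalues of A on the zero-sum vectors, the roots of
   X^2 - (lambda - mu) X - (k - mu). *)
Variables r s : int.
Hypothesis sum_rs : r + s = lambda%:Z - mu%:Z.
Hypothesis prod_rs : r * s = mu%:Z - k%:Z.

Lemma card_common_neighbours (u w : V) :
  #|neighbours adj u :&: neighbours adj w|%:Z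
    = lambda%:Z * (adj u w)%:Z + mu%:Z * (1 - (adj u w)%:Z - (u == w)%:Z)
      + k%:Z * (u == w)%:Z.
Proof.
have [_ adj_irr] := srg_simple srg.
have [<-|neq_uw] := eqVneq u w.
  by rewrite setIid (srg_regular srg) adj_irr /=; ring.
case adj_uw: (adj u w); first by rewrite (srg_adjacent srg) //=; ring.
by rewrite (srg_nonadjacent srg) ?adj_uw //=; ring.
Qed.

Lemma sum_adj_neighbours (u w : V) :
  \sum_(t | adj u t) (adj t w)%:Z = #|neighbours adj u :&: neighbours adj w|%:Z.
Proof.
have [adj_sym _] := srg_simple srg.
rewrite -sum1_card (big_morph Posz PoszD (erefl _)) big_mkcond [RHS]big_mkcond.
by apply: eq_bigr => t _; rewrite !inE (adj_sym w); case: adj; case: adj.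
Qed.

Lemma sum_adj (u : V) : \sum_(t | adj u t) 1 = k%:Z.
Proof.
rewrite -(srg_regular srg u) -sum1_card (big_morph Posz PoszD (erefl _)).
by apply: eq_bigl => t; rewrite inE.
Qed.

Lemma sum_adj_eq (u w : V) : \sum_(t | adj u t) (t == w)%:Z = (adj u w)%:Z.
Proof.
rewrite big_mkcond (bigD1 w) //= eqxx big1 => [|t /negPf->].
  by rewrite addr0; case: adj.
by case: adj.
Qed.

(** Both sides equal k^2 - (lambda - mu) k + mu - k, by counting the walks of
    length 2 from u according to their end point. *)
Lemma srg_order_mu (u : V) : v%:Z * mu%:Z = (k%:Z - r) * (k%:Z - s).
Proof.
have [adj_sym _] := srg_simple srg.
have one_sum : \sum_(w : V) 1 = v%:Z.
  by rewrite -(srg_order srg) -sum1_card (big_morph Posz PoszD (erefl _)).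
have adj_sum : \sum_w (adj u w)%:Z = k%:Z.
  by rewrite -(sum_adj u) [RHS]big_mkcond; apply: eq_bigr => w _; case: adj.
have eq_sum : \sum_w (u == w)%:Z = 1.
  by rewrite (bigD1 u) //= eqxx big1 ?addr0 // => w /negPf; rewrite eq_sym => ->.
have : \sum_w \sum_(t | adj u t) (adj t w)%:Z = k%:Z * k%:Z.
  rewrite exchange_big /= -{1}(sum_adj u) mulr_suml; apply: eq_bigr => t _.
  rewrite mul1r -(sum_adj t) [RHS]big_mkcond.
  by apply: eq_bigr => w _; case: adj.
rewrite (eq_bigr (fun w => lambda%:Z * (adj u w)%:Z
     + mu%:Z * (1 - (adj u w)%:Z - (u == w)%:Z) + k%:Z * (u == w)%:Z)).
  rewrite !big_split /= -!mulr_sumr !big_split /= !sumrN one_sum adj_sum eq_sum.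
  move=> count.
  have -> : (k%:Z - r) * (k%:Z - s) = k%:Z * k%:Z - k%:Z * (r + s) + r * s by ring.
  by rewrite sum_rs prod_rs -count; ring.
by move=> w _; rewrite sum_adj_neighbours card_common_neighbours.
Qed.

(** The decomposition A^n = k^n J/v + r^n E_r + s^n E_s, with the projections
    E_r and E_s written in terms of A, I and J; the factor v (r - s) clears
    their denominators. *)
Lemma srg_walks (n : nat) (u w : V) :
  v%:Z * (r - s) * (walks adj n u w)%:Z
    = v%:Z * (r ^+ n - s ^+ n) * (adj u w)%:Z
      + v%:Z * (r * s ^+ n - s * r ^+ n) * (u == w)%:Z
      + ((r - s) * k%:Z ^+ n - (k%:Z - s) * r ^+ n + (k%:Z - r) * s ^+ n).
Proof.
elim: n u => [|n IHn] u; first by rewrite /= !expr0; ring.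
(* The constant summand is kept opaque, so that distributing sums over
   additions leaves it whole. *)
set c := (r - s) * _ - _ + _ in IHn.
have := erefl c; rewrite {2}/c => cE; clearbody c.
rewrite [walks _ _ _ _]/= (big_morph Posz PoszD (erefl _)) mulr_sumr.
rewrite (eq_bigr _ (fun t _ => IHn t)).
rewrite !big_split /= -!mulr_sumr sum_adj_neighbours card_common_neighbours.
rewrite sum_adj_eq -[c in \sum_(_ | _) c]mulr1 -mulr_sumr (sum_adj u).
have -> : lambda%:Z * (adj u w)%:Z + mu%:Z * (1 - (adj u w)%:Z - (u == w)%:Z)
     + k%:Z * (u == w)%:Z = (r + s) * (adj u w)%:Z + mu%:Z - r * s * (u == w)%:Z.
  by rewrite sum_rs prod_rs; ring.
rewrite [X in X + _ + _](_ : _ = v%:Z * (r ^+ n - s ^+ n)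
    * ((r + s) * (adj u w)%:Z - r * s * (u == w)%:Z)
    + v%:Z * mu%:Z * (r ^+ n - s ^+ n)); last by ring.
by rewrite (srg_order_mu u) cE !exprS; ring.
Qed.

(** Summing the entries (u, x u): the diagonal contributes nothing as x moves
    every vertex, and the common factor v cancels. *)
Lemma srg_sum_walks (x : {perm V}) (n : nat) :
  (0 < v)%N -> fixed_vertices x = set0 ->
  (r - s) * (\sum_u walks adj n u (x u))%N%:Z
    = (r ^+ n - s ^+ n) * ((a1 adj x)%:Z - (k%:Z - r))
      + (r - s) * (k%:Z ^+ n - r ^+ n).
Proof.
move=> v_gt0 x_fix; apply: (@mulfI _ v%:Z); first by rewrite eqz_nat -lt0n.
rewrite mulrA (big_morph Posz PoszD (erefl _)) mulr_sumr.
rewrite (eq_bigr (fun u => v%:Z * (r ^+ n - s ^+ n) * (adj u (x u))%:Z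
  + ((r - s) * k%:Z ^+ n - (k%:Z - s) * r ^+ n + (k%:Z - r) * s ^+ n))).
  rewrite big_split /= -mulr_sumr sumr_const cardT -cardE (srg_order srg).
  have -> : \sum_u (adj u (x u))%:Z = (a1 adj x)%:Z.
    rewrite /a1 -sum1_card (big_morph Posz PoszD (erefl _)) [RHS]big_mkcond.
    by apply: eq_bigr => u _; rewrite inE; case: adj.
  by rewrite -mulr_natl natz; ring.
move=> u _; rewrite srg_walks.
have -> : (u == x u) = false.
  by have := in_set0 u; rewrite -x_fix inE eq_sym.
by rewrite mulr0 addr0.
Qed.

End Spectral.

(** * Congruences between p-th powers *)

Section PrimePowers.

Local Open Scope ring_scope.

Variable p : nat.
Hypothesis p_pr : prime p.

(** Each p-th power gains a factor p: in c^p - d^p = (c - d) * S, the p terms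
    of S are all congruent to d^(p-1) modulo p. *)
Lemma dvdz_sub_exp (a b : int) (m : nat) :
  (p%:Z %| a - b)%Z -> (p%:Z ^+ m.+1 %| a ^+ (p ^ m)%N - b ^+ (p ^ m)%N)%Z.
Proof.
move=> p_ab; elim: m => [|m IHm]; first by rewrite expn0 !expr1.
rewrite expnSr !exprM exprSr subrXX dvdz_mul //.
have : (p%:Z %| a ^+ (p ^ m)%N - b ^+ (p ^ m)%N)%Z.
  by apply: dvdz_trans IHm; rewrite exprS dvdz_mulr.
move: (a ^+ _) (b ^+ _) => c d.
rewrite !(dvdz_pcharf (pchar_Fp p_pr)) rmorphB /= subr_eq0 => /eqP cd.
rewrite rmorph_sum /= (eq_bigr (fun=> d%:~R ^+ p.-1)) => [|i _].
  by rewrite sumr_const card_ord -mulr_natl pchar_Fp_0 // mul0r.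
rewrite rmorphM !rmorphXn /= cd -exprD subnK //.
by rewrite -ltnS prednK ?prime_gt0.
Qed.

(** By Frobenius, a^(p^m) - b^(p^m) is (a - b)^(p^m) modulo p. *)
Lemma ndvdz_sub_exp (a b : int) (m : nat) :
  ~~ (p%:Z %| a - b)%Z -> ~~ (p%:Z %| a ^+ (p ^ m)%N - b ^+ (p ^ m)%N)%Z.
Proof.
rewrite !(dvdz_pcharf (pchar_Fp p_pr)) !rmorphB !rmorphXn /= => ab.
have p_nat : [pchar 'F_p].-nat (p ^ m)%N.
  by rewrite pnatX (eq_pnat _ (pcharf_eq (pchar_Fp p_pr))) pnat_id.
suff -> : forall c d : 'F_p, c ^+ (p ^ m) - d ^+ (p ^ m) = (c - d) ^+ (p ^ m).
  by rewrite expf_eq0 (negPf ab) andbF.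
move=> c d; apply/eqP; rewrite subr_eq -exprDn_pchar //.
by rewrite subrK.
Qed.

Lemma eq0_dvdz_exp (z : int) : (forall m, (p%:Z ^+ m %| z)%Z) -> z = 0.
Proof.
move=> dvd_z; apply/eqP; rewrite -absz_eq0; apply: contraT.
rewrite -lt0n => z_gt0.
have := dvd_z `|z|%N; rewrite dvdzE abszX => /(dvdn_leq z_gt0).
by rewrite leqNgt ltn_expl // prime_gt1.
Qed.

End PrimePowers.

(** * The number of vertices adjacent to their image *)

Section FixedPointFree.

Local Open Scope ring_scope.

(** Modulo p the eigenvalue s differs from both k and r, which agree. The
    trace of x on the s-eigenspace is (k - r - a1) / (r - s), and the two
    computations of tr (A^(p^m) x) show that every power of p divides it. *)
Lemma srg_a1_fixed_point_free (V : finType) (adj : rel V)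
    (v k lambda mu : nat) (r s : int) (p : nat) (x : {perm V}) :
  strongly_regular adj v k lambda mu -> (0 < v)%N ->
  r + s = lambda%:Z - mu%:Z -> r * s = mu%:Z - k%:Z ->
  prime p -> (p%:Z %| k%:Z - r)%Z -> ~~ (p%:Z %| r - s)%Z ->
  x \in graph_Aut adj -> #[x]%g = p -> fixed_vertices x = set0 ->
  (a1 adj x)%:Z = k%:Z - r.
Proof.
move=> srg v_gt0 sum_rs prod_rs p_pr p_kr p_rs x_aut x_ord x_fix.
apply/eqP; rewrite -subr_eq0; apply/eqP/(eq0_dvdz_exp p_pr) => m.
have W := srg_sum_walks srg sum_rs prod_rs (p ^ m) v_gt0 x_fix.
have pW : (p%:Z ^+ m.+1 %| (\sum_u walks adj (p ^ m) u (x u))%N%:Z)%Z.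
  by rewrite -rmorphXn /= dvdzE; exact: dvdn_sum_walks.
have p_cop : coprimez (p%:Z ^+ m.+1) (r ^+ (p ^ m)%N - s ^+ (p ^ m)%N).
  apply: coprimezXl; rewrite coprimezE prime_coprime //.
  by have := ndvdz_sub_exp p_pr m p_rs; rewrite dvdzE.
apply: (@dvdz_trans (p%:Z ^+ m.+1)); first by rewrite exprS dvdz_mull.
rewrite -(Gauss_dvdzr _ p_cop) -[X in (_ %| X)%Z](addrK ((r - s)
  * (k%:Z ^+ (p ^ m)%N - r ^+ (p ^ m)%N))) -W.
by rewrite rpredB // dvdz_mull // dvdz_sub_exp.
Qed.

End FixedPointFree.

Theorem proposition8p8 (V : finType) (adj : rel V) (x : {perm V})
  (hsrg : strongly_regular adj 640 243 66 108)
  (hx : x \in graph_Aut adj)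
  (hord : #[x]%g = 5)
  (hfix : fixed_vertices x = set0) :
  a1 adj x = 240.
Proof.
have a1E : Posz (a1 adj x) = (Posz 243 - Posz 3)%R.
  exact: (srg_a1_fixed_point_free (r := Posz 3) (s := (- Posz 45)%R) (p := 5)
            hsrg).
by case: a1E.
Qed.
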